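(* Let $\mathbf{T}=(T_1,\dots,T_n)$ and $\mathbf{S}=(S_1,\dots,S_n)$ be in $\mathcal{B}_A(\mathcal{H})^n$. Then $$\omega_A^2(\mathbf{S}^{\sharp_A}\mathbf{T})\le\inf_{\alpha,\beta}\frac{1}{\alpha+\beta}\Big\{\frac{\alpha}{2}\Big\|\sum_{k=1}^n\big((T_k^{\sharp_A}T_k)^2+(S_k^{\sharp_A}S_k)^2\big)\Big\|_A+\beta\sum_{k=1}^n\|S_k^{\sharp_A}T_k\|_A^2\Big\}\le\frac12\Big\|\sum_{k=1}^n\big((T_k^{\sharp_A}T_k)^2+(S_k^{\sharp_A}S_k)^2\big)\Big\|_A,$$ where the infimum is over all reals $\alpha,\beta\ge0$ with $(\alpha,\beta)\ne(0,0)$.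
   Context: $\mathcal{H}$ is a non-trivial complex Hilbert space, $\mathcal{B}(\mathcal{H})$ the bounded linear operators on it, $A\in\mathcal{B}(\mathcal{H})$ a fixed positive operator ($\langle Ax,x\rangle\ge0$ for all $x$), $n\ge 1$ an integer. Put $\langle x,y\rangle_A=\langle Ax,y\rangle$ and $\|x\|_A=\langle Ax,x\rangle^{1/2}$. $\mathcal{B}_A(\mathcal{H})$ is the set of $T\in\mathcal{B}(\mathcal{H})$ for which there is $W\in\mathcal{B}(\mathcal{H})$ with $AW=T^*A$ (equivalently, $\mathcal{R}(T^*A)\subseteq\mathcal{R}(A)$); for such $T$, $T^{\sharp_A}=A^\dagger T^*A$ ($A^\dagger$ the Moore–Penrose inverse) is the unique bounded $W$ with $AW=T^*A$ and $\mathcal{R}(W)\subseteq\overline{\mathcal{R}(A)}$. Every $T\in\mathcal{B}_A(\mathcal{H})$ satisfies $\|Tx\|_A\le c\|x\|_A$ for all $x$, for some $c>0$; for a single operator put $\|T\|_A=\sup_{\|x\|_A=1}\|Tx\|_A$. $\mathcal{B}_A(\mathcal{H})^n$ is the set of $n$-tuples of elements of $\mathcal{B}_A(\mathcal{H})$; $\mathbf{S}^{\sharp_A}\mathbf{T}=(S_1^{\sharp_A}T_1,\dots,S_n^{\sharp_A}T_n)$. For a tuple $\mathbf{T}$, $\omega_A(\mathbf{T})=\sup_{\|x\|_A=1}\big(\sum_{k=1}^n|\langle T_kx,x\rangle_A|^2\big)^{1/2}$. *)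

(* Defs.v *)
From HB Require Import structures.
From mathcomp Require Import all_boot all_order all_algebra.
From mathcomp Require Import complex.
From mathcomp Require Import all_classical all_reals all_analysis.

Set Implicit Arguments.
Unset Strict Implicit.
Unset Printing Implicit Defensive.

Import Order.TTheory GRing.Theory Num.Theory.
Import numFieldNormedType.Exports.

Local Open Scope classical_set_scope.
Local Open Scope ring_scope.

(* Complex Hilbert spaces. [inner] is linear in its first argument and
   conjugate-linear in its second; as R[i] is partially ordered, [0 <= z] says
   that z is real and nonnegative. *)
HB.mixin Record CompleteNormedModule_isHilbert (R : realType) (H : Type)
    of CompleteNormedModule R[i] H := {
  inner : {dot H for (@Num.conj R[i] : R[i] -> R[i])} ;
  inner_normE : forall x : H, `|x| ^+ 2 = inner x x
}.

#[short(type="hilbertType")]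
HB.structure Definition Hilbert (R : realType) :=
  {H of CompleteNormedModule R[i] H & CompleteNormedModule_isHilbert R H}.

Section semi_hilbertian.
Context {R : realType} {H : hilbertType R}.
Implicit Types (A T W : H -> H) (x y z : H).

Local Notation "<[ x , y ]>" := (inner x y) (at level 0).

Definition bounded_operator T := linear T /\ bounded_near T (nbhs (0 : H)).

Definition positive_operator A :=
  bounded_operator A /\ forall x, 0 <= <[A x, x]>.

(* T^*; the vector z below exists (for bounded T) and is unique by Riesz. *)
Definition adjoint T y : H :=
  xget 0 [set z | forall x, <[T x, y]> = <[x, z]>].

(* The Moore-Penrose inverse is an unbounded operator with domain
   R(A) + R(A)^perp: it sends y to the unique x in N(A)^perp such that y - A x
   is in R(A)^perp. Off its domain the value is the dummy 0. *)
Definition mp_inverse A y : H :=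
  xget 0 [set x | (forall z, A z = 0 -> <[x, z]> = 0) /\
                  (forall z, <[y - A x, A z]> = 0)].

Definition in_BA A T :=
  bounded_operator T /\
  exists W, bounded_operator W /\ A \o W = adjoint T \o A.

Definition sharp A T : H -> H := mp_inverse A \o adjoint T \o A.

Definition innerA A x y : R[i] := <[A x, y]>.

Definition normA A x : R := Num.sqrt (complex.Re (innerA A x x)).

(* If A = 0 the suprema below are over the empty set, and [sup set0 = 0]. *)
Definition opnormA A T : R := sup [set normA A (T x) | x in [set x | normA A x = 1]].

Definition omegaA A n (T : 'I_n -> H -> H) : R :=
  sup [set Num.sqrt (\sum_(k < n) Normc.normc (innerA A (T k x) x) ^+ 2)
      | x in [set x | normA A x = 1]].

End semi_hilbertian.

(* Main.v *)
Require Import Defs.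
From HB Require Import structures.
From mathcomp Require Import all_boot all_order all_algebra.
From mathcomp Require Import complex.
From mathcomp Require Import all_classical all_reals all_analysis.
From mathcomp Require Import ring lra.

Import Order.TTheory GRing.Theory Num.Theory.
Import numFieldNormedType.Exports.

Local Open Scope classical_set_scope.
Local Open Scope ring_scope.

(* For |x|_A = 1 we have <S^# T x, x>_A = <T x, S x>_A, and Cauchy-Schwarz gives
   |<T x, S x>_A|^2 <= <T^# T x, x>_A <S^# S x, x>_A
     <= |T^# T x|_A |S^# S x|_A <= (|T^# T x|_A^2 + |S^# S x|_A^2) / 2
     = <((T^# T)^2 + (S^# S)^2) x, x>_A / 2.
   Summing over k bounds omega_A^2 by |Q|_A / 2, where Q is the sum of the
   (T_k^# T_k)^2 + (S_k^# S_k)^2; it is also bounded by the sum of the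
   |S_k^# T_k|_A^2, hence by every convex combination of the two. The value at
   (alpha, beta) = (1, 0) is |Q|_A / 2.
   The analytic input is that adjoints and the relevant values of the
   Moore-Penrose inverse exist (projection theorem), and that the suprema are
   finite, i.e. that operators in B_A are bounded for the seminorm |.|_A. *)

(** * Complex modulus and real inequalities *)

Lemma normc_sqr (R : rcfType) (z : R[i]) :
  Normc.normc z ^+ 2 = complex.Re z ^+ 2 + complex.Im z ^+ 2.
Proof. by case: z => a b /=; rewrite sqr_sqrtr// addr_ge0 ?sqr_ge0. Qed.

Lemma normc_ge0 (R : rcfType) (z : R[i]) : 0 <= Normc.normc z.
Proof. by case: z => a b; exact: sqrtr_ge0. Qed.

(** Discriminant argument behind Cauchy-Schwarz and the projection theorem. For s > 0 the value t =
    1/s gives the claim. For s = 0 the expression is affine in t, and if b were nonzero, t = (r + 1)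
    / (2b) would make it -1. *)
Lemma quadratic_ge0_le (R : realFieldType) (r s b : R) : 0 <= r -> 0 <= s ->
  (forall t, 0 <= r - 2 * t * b + t ^+ 2 * b * s) -> b <= r * s.
Proof.
move=> r0 s0 P; have [s_eq0|s_neq0] := eqVneq s 0.
  have := P ((r + 1) / (2 * b)); rewrite s_eq0 !mulr0 addr0.
  have [-> //|b0] := eqVneq b 0.
  rewrite [X in _ - X](_ : _ = r + 1); last by field.
  lra.
have s1 : 0 < s by rewrite lt_def s_neq0.
have : 0 <= (r - 2 * s^-1 * b + s^-1 ^+ 2 * b * s) * s by rewrite mulr_ge0.
by rewrite (_ : _ * s = r * s - b) ?subr_ge0//; field.
Qed.

Lemma normcD_sqr (R : rcfType) (z w : R[i]) :
  Normc.normc (z + w) ^+ 2 <= 2 * (Normc.normc z ^+ 2 + Normc.normc w ^+ 2).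
Proof.
rewrite !normc_sqr; case: z w => [a b] [c d] /=.
have := sqr_ge0 (a - c); have := sqr_ge0 (b - d); nra.
Qed.

Lemma Re_le_normc {R : rcfType} (z : R[i]) : complex.Re z <= Normc.normc z.
Proof.
case: z => a b /=; rewrite (le_trans (ler_norm _))// -sqrtr_sqr ler_sqrt.
  by rewrite lerDl sqr_ge0.
by rewrite addr_ge0 ?sqr_ge0.
Qed.

(** If h / b = 1 + r with r > 0, Bernoulli's inequality makes the powers of h / b unbounded, so no
    constant K can dominate them. *)
Lemma le_of_pow2_bound (R : archiRealFieldType) (h b K : R) : 0 < b -> 0 <= K ->
  (forall j, h ^+ (2 ^ j) <= K * b ^+ (2 ^ j)) -> h <= b.
Proof.
move=> b0 K0 hK; rewrite leNgt; apply/negP => bh.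
pose r := h / b - 1.
have r0 : 0 < r by rewrite subr_gt0 ltr_pdivlMr// mul1r.
have hbr : h / b = 1 + r by rewrite addrC subrK.
have bernoulli n : 1 + n%:R * r <= (h / b) ^+ n.
  rewrite hbr; elim: n => [|n IH]; first by rewrite mul0r addr0 expr0.
  rewrite exprS (le_trans _ (ler_wpM2l _ IH))//; last by rewrite addr_ge0// ltW.
  by rewrite -natr1; have := sqr_ge0 r; have := ler0n R n; nra.
(* For j the Archimedean bound of K / r one has K / r < j < 2^j, so 1 + 2^j r exceeds K. *)
have := bernoulli (2 ^ Num.bound (K / r))%N.
apply/negP; rewrite -ltNge expr_div_n ltr_pdivrMr ?exprn_gt0//.
rewrite (le_lt_trans (hK _))// ltr_pM2r ?exprn_gt0//.
rewrite ltr_wpDl// -ltr_pdivrMr//.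
rewrite (lt_le_trans (archi_boundP _)) ?divr_ge0 ?(ltW r0)//.
by rewrite ler_nat ltnW// ltn_expl.
Qed.

(** * Positive semidefinite sesquilinear forms *)

Section positive_form.
Context {R : realType} {V : lmodType R[i]} (f : V -> V -> R[i]).
Hypothesis f_linearl : forall a x y z, f (a *: x + y) z = a * f x z + f y z.
Hypothesis f_linearr : forall a x y z, f z (a *: x + y) = conjc a * f z x + f z y.
Hypothesis f_ge0 : forall x, 0 <= f x x.

Let Re0 x : 0 <= complex.Re (f x x).
Proof. by have := f_ge0 x; rewrite lecE => /andP[]. Qed.

Let Im0 x : complex.Im (f x x) = 0.
Proof. exact: ger0_Im. Qed.

Lemma form_expand a x y :
  f (a *: x + y) (a *: x + y) =
  a * conjc a * f x x + a * f x y + conjc a * f y x + f y y.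
Proof. rewrite f_linearl !f_linearr; ring. Qed.

(** Symmetry follows from positivity by polarization: the form is real at x + y, which makes the
    imaginary parts opposite, and at ix + y, which makes the real parts equal. *)
Lemma form_conj x y : f x y = conjc (f y x).
Proof.
have := Im0 (1 *: x + y); have := Im0 ('i%C *: x + y).
rewrite !form_expand; have := Im0 x; have := Im0 y.
case: (f x x) (f y y) (f x y) (f y x) => [a b] [c d] [e g] [h k] /=.
move=> -> -> E1 E2; apply/eqP; rewrite eq_complex /=.
by apply/andP; split; apply/eqP; lra.
Qed.

Lemma form_CauchySchwarz x y :
  Normc.normc (f x y) ^+ 2 <= complex.Re (f x x) * complex.Re (f y y).
Proof.
set b := Normc.normc (f x y) ^+ 2.
(* Positivity at x - t f(x,y) y: the coefficient f(x,y) turns the cross terms into -2t |f(x,y)|^2.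
   Nothing is divided by f(y,y), which may vanish. *)
have P t : 0 <= complex.Re (f x x) - 2 * t * b + t ^+ 2 * b * complex.Re (f y y).
  have := Re0 ((- (t%:C%C * f x y)) *: y + x).
  rewrite form_expand (form_conj y x) /b normc_sqr; have := Im0 x; have := Im0 y.
  case: (f x x) (f y y) (f x y) => [a b1] [c d] [e g] /= -> _.
  set u := (X in 0 <= X) => u0; set v := (X in 0 <= X); suff -> : v = u by [].
  by rewrite /u /v; ring.
exact: quadratic_ge0_le (Re0 x) (Re0 y) P.
Qed.

Lemma form_triangle x y :
  Num.sqrt (complex.Re (f (x + y) (x + y))) <=
  Num.sqrt (complex.Re (f x x)) + Num.sqrt (complex.Re (f y y)).
Proof.
have sr z := sqrtr_ge0 (complex.Re (f z z)).
rewrite -(ler_pXn2r (ltn0Sn 1)) ?nnegrE ?addr_ge0 ?sr//.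
rewrite sqrrD !sqr_sqrtr ?Re0//.
have := form_expand 1 x y; rewrite scale1r => ->.
have CS : complex.Re (f x y) <=
    Num.sqrt (complex.Re (f x x)) * Num.sqrt (complex.Re (f y y)).
  rewrite (le_trans (ler_norm _))// -(ler_pXn2r (ltn0Sn 1)) ?nnegrE ?mulr_ge0 ?sr//.
  rewrite exprMn !sqr_sqrtr ?Re0// (le_trans _ (form_CauchySchwarz x y))//.
  by rewrite normc_sqr real_normK ?num_real// lerDl sqr_ge0.
move: CS; rewrite (form_conj y x).
case: (f x x) (f y y) (f x y) => [a b] [c d] [e g] /=.
lra.
Qed.

End positive_form.

(** * Squared norm, closed sets and completeness in a Hilbert space *)

Section hilbert.
Context {R : realType} {H : hilbertType R}.
Implicit Types (x y z : H) (T : H -> H) (M : set H).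

Definition sqnorm x : R := complex.Re (inner x x).

Lemma inner_linearl a x y z : inner (a *: x + y) z = a * inner x z + inner y z.
Proof. by rewrite linearDl linearZl_LR. Qed.

Lemma inner_conj x y : inner x y = conjc (inner y x).
Proof. by rewrite hermC expr0 mul1r. Qed.

Lemma inner_linearr a x y z :
  inner z (a *: x + y) = conjc a * inner z x + inner z y.
Proof. by rewrite linearDr linearZr_LR. Qed.

Lemma inner_ge0 x : 0 <= inner x x.
Proof. exact: dnorm_ge0. Qed.

Lemma inner_CauchySchwarz x y :
  Normc.normc (inner x y) ^+ 2 <= sqnorm x * sqnorm y.
Proof.
exact: (form_CauchySchwarz _ inner_linearl inner_linearr inner_ge0).
Qed.

Lemma sqnorm_ge0 x : 0 <= sqnorm x.
Proof. by have := inner_ge0 x; rewrite lecE => /andP[]. Qed.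

Lemma innerE x : inner x x = (sqnorm x)%:C%C.
Proof. by rewrite /sqnorm RRe_real// ger0_real// inner_ge0. Qed.

Lemma norm_sqnorm x : `|x| = (Num.sqrt (sqnorm x))%:C%C.
Proof.
apply/eqP; rewrite -(eqrXn2 (ltn0Sn 1))// ?ler0c ?sqrtr_ge0//.
by rewrite inner_normE -rmorphXn/= sqr_sqrtr ?sqnorm_ge0// innerE.
Qed.

Lemma bounded_operator_sqnorm T : bounded_operator T ->
  exists2 M, 0 <= M & forall x, sqnorm (T x) <= M * sqnorm x.
Proof.
move=> [linT bT].
pose L := GRing.isLinear.Build _ _ _ _ T linT.
pose T' : {linear H -> H} := HB.pack T L.
have /linear_boundedP/pinfty_ex_gt0[r r0 Tr] : bounded_near T' (nbhs (0 : H)) by [].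
exists (complex.Re r ^+ 2) => [|x]; first exact: sqr_ge0.
have := Tr x; rewrite !norm_sqnorm.
have -> : r = (complex.Re r)%:C%C by rewrite RRe_real// gtr0_real.
rewrite -rmorphM lecR /= => Trx.
have r0' : 0 <= complex.Re r by move: r0; rewrite ltcE => /andP[_ /ltW].
rewrite -(sqr_sqrtr (sqnorm_ge0 (T x))).
rewrite -[X in _ <= _ * X](sqr_sqrtr (sqnorm_ge0 x)) -exprMn.
by rewrite ler_pXn2r ?nnegrE ?mulr_ge0 ?sqrtr_ge0.
Qed.

(** Meant for kernels: there f(x) is a squared size of the image of x, unchanged when an element m
    of the kernel is subtracted from x, hence controlled by the squared distance to m. *)
Lemma closed_sqnorm M (f : H -> R) C : 0 <= C ->
  (forall x m, M m -> f x <= C * sqnorm (x - m)) -> (forall x, f x <= 0 -> M x) ->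
  closed M.
Proof.
move=> C0 fC fM x clx; apply/fM/ler_addgt0Pr => e e0; rewrite add0r.
have C1 : 0 < C + 1 by rewrite ltr_wpDl.
have r0 : 0 < (Num.sqrt (e / (C + 1)))%:C%C by rewrite ltcR sqrtr_gt0 divr_gt0.
have [m [Mm]] := clx _ (nbhsx_ballx x _ r0).
rewrite -ball_normE /ball_/= norm_sqnorm ltcR ltr_sqrt ?divr_gt0// => xm.
rewrite (le_trans (fC _ _ Mm))//.
move: xm; rewrite ltr_pdivlMr// => /ltW; apply: le_trans.
by have := sqnorm_ge0 (x - m); nra.
Qed.

Lemma sqnorm_cvg (u : nat -> H) (x : H) e : u @ \oo --> x -> 0 < e ->
  \forall n \near \oo, sqnorm (x - u n) < e.
Proof.
move=> /cvgrPdist_lt/(_ (Num.sqrt e)%:C%C) ux e0.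
have e0' : 0 < (Num.sqrt e)%:C%C by rewrite ltcR sqrtr_gt0.
near=> n; have : `|x - u n| < (Num.sqrt e)%:C%C by near: n; exact: ux.
by rewrite norm_sqnorm ltcR ltr_sqrt.
Unshelve. all: by end_near. Qed.

(** Completeness enters here. The rate is the one that the parallelogram law yields for a minimizing
    sequence with errors 1/(n+1). *)
Lemma sqnorm_cauchy (u : nat -> H) :
  (forall n m, sqnorm (u n - u m) <= 2 / n.+1%:R + 2 / m.+1%:R) -> cvgn u.
Proof.
move=> uC; apply/cauchy_cvgP; apply/cauchy_ballP => e e0.
have er : e = (complex.Re e)%:C%C by rewrite RRe_real// gtr0_real.
have e1 : 0 < complex.Re e by rewrite er ltcR in e0.
have small : \forall n \near \oo, 2 / n.+1%:R < complex.Re e ^+ 2 / 2.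
  have e4 : 0 < complex.Re e ^+ 2 / 4 by rewrite divr_gt0 ?exprn_gt0.
  have := near_infty_natSinv_lt (PosNum e4).
  apply: filterS => n /= ltn; rewrite mulrC -ltr_pdivlMr// (lt_le_trans ltn)//; lra.
near_simpl; near=> a b => /=.
rewrite -ball_normE /ball_/= norm_sqnorm er ltcR.
rewrite -(ltr_pXn2r (ltn0Sn 1)) ?nnegrE ?sqrtr_ge0 ?(ltW e1)// sqr_sqrtr ?sqnorm_ge0//.
have Ha : 2 / a.+1%:R < complex.Re e ^+ 2 / 2 by near: a; exact: small.
have Hb : 2 / b.+1%:R < complex.Re e ^+ 2 / 2 by near: b; exact: small.
by rewrite (le_lt_trans (uC _ _))// [ltRHS]splitr ltrD.
Unshelve. all: by end_near. Qed.

Lemma sqnorm_expand (a : R[i]) x y : sqnorm (a *: x + y) =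
  Normc.normc a ^+ 2 * sqnorm x + 2 * complex.Re (a * inner x y) + sqnorm y.
Proof.
rewrite {1}/sqnorm inner_linearl !inner_linearr (inner_conj y x) normc_sqr !innerE.
by case: (inner x y) a => [e g] [h k] /=; ring.
Qed.

Lemma sqnormZ (a : R[i]) x : sqnorm (a *: x) = Normc.normc a ^+ 2 * sqnorm x.
Proof.
rewrite -[a *: x]addr0 sqnorm_expand linear0r mulr0 /= mulr0.
by rewrite addr0 /sqnorm linear0r addr0.
Qed.

Lemma sqnorm_parallelogram x y :
  sqnorm (x + y) + sqnorm (x - y) = 2 * (sqnorm x + sqnorm y).
Proof.
rewrite -(scale1r x) addrC sqnorm_expand addrC sqnorm_expand scale1r.
rewrite linearNr !mul1r raddfN/= -(scaleN1r y) sqnormZ !normc_sqr /=.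
rewrite ?(expr1n, expr0n) ?addr0 ?sqrtr1.
by ring.
Qed.

(** * Projection theorem for a closed subspace *)

Section projection.
Variables (M : set H) (M0 : M 0).
Hypothesis M_linear : forall a x y, M x -> M y -> M (a *: x + y).
Variables (x : H).
Let d := inf [set sqnorm (x - m) | m in M].

Let d_le m : M m -> d <= sqnorm (x - m).
Proof.
move=> Mm; apply: ge_inf; last by exists m.
by exists 0 => _ [y _ <-]; exact: sqnorm_ge0.
Qed.

(** Moving m inside M by t <x - m, z> z cannot bring the squared distance below d, which is a
    quadratic condition on t. Along a minimizing sequence the bound tends to 0, so orthogonality
    passes to the limit without showing that the infimum is attained. *)
Lemma near_minimizer_orthogonal m z : M m -> M z ->
  Normc.normc (inner (x - m) z) ^+ 2 <= (sqnorm (x - m) - d) * sqnorm z.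
Proof.
move=> Mm Mz; apply: quadratic_ge0_le => [||t].
- by rewrite subr_ge0 d_le.
- exact: sqnorm_ge0.
pose c : R[i] := t%:C%C * inner (x - m) z.
have := d_le _ (M_linear c _ _ Mz Mm).
rewrite (_ : x - (c *: z + m) = (- c) *: z + (x - m)); last first.
  by rewrite opprD addrCA scaleNr.
rewrite sqnorm_expand (inner_conj z) -subr_ge0 /c !normc_sqr.
case: (inner _ _) => a b /=.
set u := (X in 0 <= X) => u0; set v := (X in 0 <= X); suff -> : v = u by [].
by rewrite /u /v; ring.
Qed.

Lemma orthogonal_projection : closed M ->
  exists2 p, M p & forall z, M z -> inner (x - p) z = 0.
Proof.
move=> clM.
have infD : has_inf [set sqnorm (x - m) | m in M].
  split; first by exists (sqnorm (x - 0)), 0.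
  by exists 0 => _ [y _ <-]; exact: sqnorm_ge0.
have /choice[u uP] n : exists m, M m /\ sqnorm (x - m) < d + n.+1%:R^-1.
  have [|_ [m Mm <-] lem] := @inf_adherent _ _ n.+1%:R^-1 _ infD.
    by rewrite invr_gt0.
  by exists m.
have Mu n : M (u n) by have [] := uP n.
have u_cvg : cvgn u.
  apply: sqnorm_cauchy => n k.
  have := sqnorm_parallelogram (x - u n) (x - u k).
  rewrite (_ : x - u n + (x - u k) = 2 *: (x - 2^-1 *: (u n + u k))); last first.
    rewrite scalerBr scalerA divff ?pnatr_eq0// scale1r scaler_nat mulr2n.
    by rewrite opprD addrACA.
  rewrite (_ : x - u n - _ = - (u n - u k)); last first.
    by rewrite !opprB addrC addrA subrK.
  rewrite -[- (u n - u k)]scaleN1r !sqnormZ !normc_sqr /=.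
  (* The midpoint of u_n and u_k lies in M, so its squared distance to x is at least d; in the
     parallelogram law the terms in d cancel. *)
  have := d_le _ (M_linear 2^-1 _ _ (M_linear 1 _ _ (Mu n) (Mu k)) M0).
  rewrite scale1r addr0.
  have [_] := uP n; have [_] := uP k.
  move: (n.+1%:R^-1 : R) (k.+1%:R^-1 : R) => i j.
  lra.
have up := u_cvg; set p := limn u in up.
have Mp : M p by apply: (closed_cvg M clM _ _ up); exact: nearW.
exists p => // z Mz.
apply: Normc.eq0_normc; apply/eqP; rewrite -sqrf_eq0 eq_le sqr_ge0 andbT.
apply/ler_addgt0Pr => e e0; rewrite add0r.
have z1 : 0 < sqnorm z + 1 by rewrite ltr_wpDl ?sqnorm_ge0.
(* [normcD_sqr] costs a factor 2 on a sum of two terms, so each of them has to be at most e / 4;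
   adding 1 avoids dividing by 0. *)
pose e' := e / 4 / (sqnorm z + 1).
have e'0 : 0 < e' by rewrite !divr_gt0.
near \oo => n.
rewrite (_ : x - p = (x - u n) + (- (p - u n))); last first.
  by rewrite opprB addrA subrK.
rewrite linearDl (le_trans (normcD_sqr _ _ _))//.
have H1 : Normc.normc (inner (x - u n) z) ^+ 2 <= e' * sqnorm z.
  rewrite (le_trans (near_minimizer_orthogonal _ _ _ _))// ler_wpM2r ?sqnorm_ge0//.
  have [_ /ltW/le_trans] := uP n; rewrite lerBlDl; apply; rewrite lerD2l ltW//.
  by near: n; exact: (near_infty_natSinv_lt (PosNum e'0)).
have H2 : Normc.normc (inner (- (p - u n)) z) ^+ 2 <= e' * sqnorm z.
  rewrite linearNl normcN (le_trans (inner_CauchySchwarz _ _))//.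
  rewrite ler_wpM2r ?sqnorm_ge0// ltW//.
  by near: n; exact: sqnorm_cvg.
have H3 : e' * sqnorm z <= e / 4.
  by rewrite /e' mulrAC ler_pdivrMr// ler_pM2l ?divr_gt0// lerDl.
lra.
Unshelve. all: by end_near. Qed.

End projection.

(* Riesz representation of the bounded functional [x |-> <T x, y>]: a vector of
   the orthogonal complement of its kernel, suitably scaled. *)
Lemma adjointP T : bounded_operator T ->
  forall x y, inner (T x) y = inner x (adjoint T y).
Proof.
move=> bT x y; rewrite /adjoint; case: xgetP => [z _ ->//|noz].
exfalso; have [linT _] := bT.
have [C C0 TC] := bounded_operator_sqnorm _ bT.
have T0 : T 0 = 0 by have := linT (-1) 0 0; rewrite scaleN1r oppr0 addr0 scaleN1r addNr.
pose K := [set x | inner (T x) y = 0].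
have K0 : K 0 by rewrite /K /= T0 linear0l.
have Klin a u v : K u -> K v -> K (a *: u + v).
  by rewrite /K /= linT inner_linearl => -> ->; rewrite mulr0 addr0.
have clK : closed K.
  apply: (closed_sqnorm K (fun v => Normc.normc (inner (T v) y) ^+ 2) (C * sqnorm y)).
  - by rewrite mulr_ge0 ?sqnorm_ge0.
  - move=> v m Km.
    have -> : inner (T v) y = inner (T (v - m)) y.
      rewrite -[v in LHS](subrK m) -{1}(scale1r (v - m)) linT inner_linearl.
      by rewrite (_ : inner (T m) y = 0) ?mul1r ?addr0.
    rewrite (le_trans (inner_CauchySchwarz _ _))// mulrAC.
    exact: ler_wpM2r (sqnorm_ge0 _) _ _ (TC _).
  - move=> v Tv0; apply: Normc.eq0_normc; apply/eqP.
    by rewrite -sqrf_eq0 eq_le Tv0 sqr_ge0.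
have [all0|/existsNP[w wK]] := pselect (forall x, K x).
  by apply: (noz 0) => u; rewrite linear0r; exact: all0.
have [p Kp wp] := orthogonal_projection K K0 Klin w clK.
pose h := w - p.
have Th : inner (T h) y = inner (T w) y.
  by rewrite /h -scaleN1r addrC linT inner_linearl (_ : inner (T p) y = 0) ?mulr0 ?add0r.
have h0 : inner h h != 0.
  rewrite dnorm_eq0; apply/eqP => h0; apply: wK.
  by rewrite /K /= -Th h0 T0 linear0l.
pose a := inner (T h) y / inner h h.
apply: (noz (conjc a *: h)) => u.
rewrite (_ : inner u _ = a * inner u h); last by rewrite linearZr_LR /= conjCK.
(* Subtracting from u the right multiple of h lands in the kernel, which is orthogonal to h; this
   determines <u, h>. *)
have Ku : K ((- (inner (T u) y / inner (T h) y)) *: h + u).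
  rewrite /K /= linT inner_linearl mulNr divfK ?addNr// Th; exact/eqP.
have := wp _ Ku; rewrite -/h inner_conj inner_linearl => /eqP.
rewrite conjc_eq0 => /eqP.
have Th0 : inner (T h) y != 0 by rewrite Th; exact/eqP.
rewrite mulNr => /eqP; rewrite addrC subr_eq0 => /eqP ->.
by rewrite /a; field; apply/andP; split.
Qed.

End hilbert.

(** * The semi-inner product of A and the A-adjoint *)

Section semi_hilbertian.
Context {R : realType} {H : hilbertType R} {A : H -> H}.
Hypothesis A_pos : positive_operator A.
Implicit Types (x y z : H) (T W : H -> H).

Let A_linear a x y : A (a *: x + y) = a *: A x + A y.
Proof. by have [[linA _] _] := A_pos; exact: linA. Qed.

Let innerA_linearl a x y z :
  innerA A (a *: x + y) z = a * innerA A x z + innerA A y z.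
Proof. by rewrite /innerA A_linear inner_linearl. Qed.

Let innerA_linearr a x y z :
  innerA A z (a *: x + y) = conjc a * innerA A z x + innerA A z y.
Proof. exact: inner_linearr. Qed.

Let innerA_ge0 x : 0 <= innerA A x x.
Proof. by have [_] := A_pos; apply. Qed.

Lemma innerA_conj x y : innerA A x y = conjc (innerA A y x).
Proof. exact: (form_conj _ innerA_linearl innerA_linearr innerA_ge0). Qed.

Lemma Re_innerA_ge0 x : 0 <= complex.Re (innerA A x x).
Proof. by have := innerA_ge0 x; rewrite lecE => /andP[]. Qed.

Lemma normA_ge0 x : 0 <= normA A x.
Proof. exact: sqrtr_ge0. Qed.

Lemma normA_sqr x : normA A x ^+ 2 = complex.Re (innerA A x x).
Proof. by rewrite sqr_sqrtr ?Re_innerA_ge0. Qed.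

Lemma innerA_CauchySchwarz x y :
  Normc.normc (innerA A x y) <= normA A x * normA A y.
Proof.
rewrite -(ler_pXn2r (ltn0Sn 1)) ?nnegrE ?mulr_ge0 ?normA_ge0 ?normc_ge0//.
rewrite exprMn !normA_sqr.
exact: (form_CauchySchwarz _ innerA_linearl innerA_linearr innerA_ge0).
Qed.

Lemma normAD x y : normA A (x + y) <= normA A x + normA A y.
Proof. exact: (form_triangle _ innerA_linearl innerA_linearr innerA_ge0). Qed.

Let A0 : A 0 = 0.
Proof.
by have := A_linear (-1) 0 0; rewrite scaler0 addr0 scaleN1r addNr.
Qed.

(** The range of A is in the domain of the Moore-Penrose inverse, so the dummy value does not occur:
    if p is the projection of w on the closed kernel of A, then w - p qualifies. For any qualifying
    x, the vector A w - A x = A (w - x) is orthogonal to itself. *)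
Lemma A_mp_inverse w : A (mp_inverse A (A w)) = A w.
Proof.
have kernel_proj : exists2 p, A p = 0 & forall z, A z = 0 -> inner (w - p) z = 0.
  apply: (orthogonal_projection [set z | A z = 0]) => //= [a x y /= Ax Ay|].
    by rewrite A_linear Ax Ay scaler0 addr0.
  have [C C0 AC] := bounded_operator_sqnorm _ (proj1 A_pos).
  apply: (closed_sqnorm _ (fun x => sqnorm (A x)) C) => //= [x m Am|x Ax0].
    suff -> : A x = A (x - m) by exact: AC.
    by rewrite -[x in LHS](subrK m) -{1}(scale1r (x - m)) A_linear Am scale1r addr0.
  apply/eqP; rewrite -(dnorm_eq0 inner) innerE.
  by apply/eqP; congr (_%:C%C); apply/eqP; rewrite eq_le Ax0 sqnorm_ge0.
have [p Ap wp] := kernel_proj.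
rewrite /mp_inverse; case: xgetP => [x _ [_ /(_ (w - x))]|/(_ (w - p))].
  have -> : A (w - x) = A w - A x by rewrite -scaleN1r addrC A_linear scaleN1r addrC.
  by move/eqP; rewrite dnorm_eq0 subr_eq0 => /eqP.
case; split => [//|z].
have -> : A (w - p) = A w by rewrite -scaleN1r addrC A_linear Ap scaler0 add0r.
by rewrite subrr linear0l.
Qed.

(** T^* A x = A W x lies in the range of A, where A composed with its Moore-Penrose inverse is the
    identity; hence A T^# = T^* A. *)
Lemma innerA_sharp T x y : in_BA A T ->
  innerA A (sharp A T x) y = innerA A x (T y).
Proof.
move=> [bT [W [bW AW]]]; rewrite /innerA /sharp /=.
have AWx : A (W x) = adjoint T (A x) by rewrite -[LHS]/((A \o W) x) AW.
by rewrite -AWx A_mp_inverse AWx inner_conj -adjointP// -inner_conj.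
Qed.

(** * Operators bounded for the A-seminorm *)

Definition Abounded T := exists2 c, 0 <= c &
  forall x, normA A (T x) <= c * normA A x.

Lemma normA_le_sqnorm : exists2 C, 0 <= C &
  forall x, normA A x ^+ 2 <= C * sqnorm x.
Proof.
have [C C0 AC] := bounded_operator_sqnorm _ (proj1 A_pos).
(* C bounds the square of the norm of A, and C <= (C + 1)^2. *)
exists (C + 1) => [|x]; first by rewrite addr_ge0.
rewrite normA_sqr (le_trans (Re_le_normc _))//.
rewrite -(ler_pXn2r (ltn0Sn 1)) ?nnegrE ?mulr_ge0 ?addr_ge0 ?sqnorm_ge0 ?normc_ge0//.
rewrite (le_trans (inner_CauchySchwarz _ _))//.
have := AC x; have := sqnorm_ge0 x; have := sqnorm_ge0 (A x); nra.
Qed.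

(* With [V = W T] the operator [A V = T^* A T] is selfadjoint, so Cauchy-Schwarz
   gives [|V^m x|_A^4 <= |V^(2m) x|_A^2 |x|_A^2]; iterating this along powers of
   two turns the bound on [V] for the norm of [H] into one for [|.|_A]. *)
Lemma in_BA_Abounded T : in_BA A T -> Abounded T.
Proof.
move=> [bT [W [bW AW]]]; pose V := W \o T.
have [CT CT0 TC] := bounded_operator_sqnorm _ bT.
have [CW CW0 WC] := bounded_operator_sqnorm _ bW.
have [C C0 AC] := normA_le_sqnorm.
have VT x y : innerA A (V x) y = innerA A (T x) (T y).
  rewrite /innerA /V /= -[A (W _)]/((A \o W) _) AW /=.
  by rewrite inner_conj -adjointP// -inner_conj.
have Vadj x y : innerA A (V x) y = innerA A x (V y).
  by rewrite VT innerA_conj -VT -innerA_conj.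
have iterV m x y : innerA A (iter m V x) y = innerA A x (iter m V y).
  by elim: m y => //= m IH y; rewrite Vadj IH -iterSr.
pose B := CW * CT + 1.
have B0 : 0 < B by rewrite ltr_wpDl ?mulr_ge0.
have VB m x : sqnorm (iter m V x) <= B ^+ m * sqnorm x.
  elim: m => [|m IH] /=; first by rewrite mul1r.
  rewrite exprS -mulrA (le_trans (WC _))//.
  rewrite (le_trans (ler_wpM2l CW0 (TC _)))//.
  rewrite (@le_trans _ _ (B * sqnorm (iter m V x)))//.
    by rewrite mulrA ler_wpM2r ?sqnorm_ge0// lerDl.
  by rewrite ler_wpM2l// ltW.
have iter_double m x :
    (normA A (iter m V x) ^+ 2) ^+ 2 <= normA A (iter (m + m) V x) ^+ 2 * normA A x ^+ 2.
  rewrite -exprMn ler_pXn2r ?nnegrE ?mulr_ge0 ?normA_ge0 ?exprn_ge0//.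
  rewrite normA_sqr iterV -iterD (le_trans (Re_le_normc _))//.
  by rewrite mulrC innerA_CauchySchwarz.
have VA x : normA A (V x) ^+ 2 <= B * normA A x ^+ 2.
  have [x0|x0] := eqVneq (normA A x) 0.
    have := iter_double 1%N x; rewrite x0 expr0n !mulr0 /= => Vx0.
    have : (normA A (V x) ^+ 2) ^+ 2 == 0 by rewrite eq_le Vx0 sqr_ge0.
    by rewrite sqrf_eq0 => /eqP ->.
  have x1 : 0 < normA A x ^+ 2 by rewrite exprn_gt0// lt_def x0 normA_ge0.
  rewrite -ler_pdivrMr//.
  (* With h = |V x|_A^2 / |x|_A^2, [iter_double] gives h^(2^j) <= |V^(2^j) x|_A^2 / |x|_A^2. The
     bounds on the norm of H then give K B^(2^j) with K independent of j. *)
  apply: (@le_of_pow2_bound _ _ _ (C * sqnorm x / normA A x ^+ 2)) => // [|j].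
    by rewrite divr_ge0 ?sqr_ge0 // mulr_ge0 ?sqnorm_ge0.
  rewrite (@le_trans _ _ (normA A (iter (2 ^ j) V x) ^+ 2 / normA A x ^+ 2))//.
    elim: j => [|j IH]; first by rewrite expn0 expr1.
    rewrite expnS mulSn mul1n exprD -expr2.
    rewrite (@le_trans _ _ ((normA A (iter (2 ^ j) V x) ^+ 2 / normA A x ^+ 2) ^+ 2))//.
      by rewrite lerXn2r ?nnegrE ?exprn_ge0 ?divr_ge0 ?sqr_ge0.
    rewrite expr_div_n ler_pdivrMr ?(exprn_gt0 2 x1)// (le_trans (iter_double _ _))//.
    by rewrite [(normA A x ^+ 2) ^+ 2]expr2 [leRHS]mulrA divfK// sqrf_eq0.
  rewrite [leRHS]mulrAC ler_pM2r ?invr_gt0//.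
  by rewrite (le_trans (AC _))// -mulrA ler_wpM2l// mulrC VB.
(* |T x|_A^2 = <V x, x>_A <= |V x|_A |x|_A, whose square is at most B |x|_A^4; and B <= (B +
   1)^2. *)
exists (Num.sqrt (B + 1)) => [|x]; first exact: sqrtr_ge0.
rewrite -(ler_pXn2r (ltn0Sn 1)) ?nnegrE ?mulr_ge0 ?normA_ge0 ?sqrtr_ge0//.
have B1 : 0 <= B + 1 by rewrite addr_ge0// ltW.
rewrite exprMn (sqr_sqrtr B1).
rewrite -(ler_pXn2r (ltn0Sn 1)) ?nnegrE ?mulr_ge0 ?exprn_ge0 ?normA_ge0//.
rewrite (@le_trans _ _ (normA A (V x) ^+ 2 * normA A x ^+ 2))//.
  rewrite -exprMn ler_pXn2r ?nnegrE ?mulr_ge0 ?exprn_ge0 ?normA_ge0//.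
  by rewrite normA_sqr -VT (le_trans (Re_le_normc _))// innerA_CauchySchwarz.
have := VA x; have := sqr_ge0 (normA A x); nra.
Qed.

Lemma Abounded_comp T W : Abounded T -> Abounded W -> Abounded (T \o W).
Proof.
move=> [c c0 Tc] [d d0 Wd]; exists (c * d) => [|x]; first exact: mulr_ge0.
by rewrite (le_trans (Tc _))// -mulrA ler_wpM2l.
Qed.

(** The constant of T works: |T^# x|_A^2 = <x, T T^# x>_A <= c |x|_A |T^# x|_A, and a nonzero |T^#
    x|_A cancels. *)
Lemma Abounded_sharp T : in_BA A T -> Abounded (sharp A T).
Proof.
move=> TB; have [c c0 Tc] := in_BA_Abounded _ TB; exists c => // x.
have [->|x0] := eqVneq (normA A (sharp A T x)) 0; first by rewrite mulr_ge0 ?normA_ge0.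
have x1 : 0 < normA A (sharp A T x) by rewrite lt_def x0 normA_ge0.
rewrite -(ler_pM2r x1) -expr2 normA_sqr innerA_sharp//.
rewrite (le_trans (Re_le_normc _))// (le_trans (innerA_CauchySchwarz _ _))//.
by rewrite mulrAC [leRHS]mulrC ler_wpM2l ?normA_ge0.
Qed.

Lemma normA0 : normA A 0 = 0.
Proof. by rewrite /normA /innerA linear0r sqrtr0. Qed.

Lemma Abounded_add T W : Abounded T -> Abounded W -> Abounded (fun x => T x + W x).
Proof.
move=> [c c0 Tc] [d d0 Wd]; exists (c + d) => [|x]; first exact: addr_ge0.
by rewrite mulrDl (le_trans (normAD _ _))// lerD.
Qed.

Lemma Abounded_sum n (T : 'I_n -> H -> H) : (forall k, Abounded (T k)) ->
  Abounded (fun x => \sum_(k < n) T k x).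
Proof.
move=> TB; have /choice[c cP] k :
    exists c, 0 <= c /\ forall x, normA A (T k x) <= c * normA A x.
  by have [c] := TB k; exists c.
exists (\sum_(k < n) c k) => [|x]; first by apply: sumr_ge0 => k _; have [] := cP k.
rewrite mulr_suml; apply: (big_ind2 (fun u v => normA A u <= v)).
- by rewrite normA0.
- by move=> u a v b ua vb; rewrite (le_trans (normAD _ _))// lerD.
- by move=> k _; have [_] := cP k.
Qed.

(** A-boundedness is what makes the supremum genuine, since [sup] of an unbounded set is 0. *)
Lemma opnormA_ub T x : Abounded T -> normA A x = 1 -> normA A (T x) <= opnormA A T.
Proof.
move=> [c c0 Tc] x1; apply: ub_le_sup; last by exists x.
by exists c => _ [y y1 <-]; rewrite (le_trans (Tc _))// y1 mulr1.
Qed.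

Lemma opnormA_ge0 T : 0 <= opnormA A T.
Proof.
rewrite /opnormA; set E := (X in sup X).
have [[e Ee] |/nonemptyPn ->] := pselect (E !=set0); last by rewrite sup0.
have [ubE|noub] := pselect (has_ubound E); last by rewrite sup_out// => -[].
have [y _ ye] := Ee.
by rewrite (le_trans _ (ub_le_sup ubE Ee))// -ye normA_ge0.
Qed.

(** * The A-selfadjoint operators T^# T and the termwise estimate *)

Lemma innerA_sharpK T x y : in_BA A T ->
  innerA A (sharp A T (T x)) y = innerA A x (sharp A T (T y)).
Proof.
by move=> TB; rewrite innerA_sharp// innerA_conj -innerA_sharp// -innerA_conj.
Qed.

Lemma normA_sharpK_sqr T x : in_BA A T ->
  normA A (sharp A T (T x)) ^+ 2 =
  complex.Re (innerA A (iter 2 (sharp A T \o T) x) x).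
Proof. by move=> TB; rewrite normA_sqr /= [in RHS]innerA_sharpK. Qed.

Lemma normA_sqr_le_sharpK T x : in_BA A T -> normA A x = 1 ->
  normA A (T x) ^+ 2 <= normA A (sharp A T (T x)).
Proof.
move=> TB x1; rewrite normA_sqr -innerA_sharp// (le_trans (Re_le_normc _))//.
by rewrite (le_trans (innerA_CauchySchwarz _ _))// x1 mulr1.
Qed.

Lemma innerA_sharp_comp_le T S x : in_BA A T -> in_BA A S -> normA A x = 1 ->
  Normc.normc (innerA A (sharp A S (T x)) x) ^+ 2 <=
  2^-1 * complex.Re (innerA A (iter 2 (sharp A T \o T) x
                               + iter 2 (sharp A S \o S) x) x).
Proof.
move=> TB SB x1.
have -> : complex.Re (innerA A (iter 2 (sharp A T \o T) x
                               + iter 2 (sharp A S \o S) x) x) =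
    normA A (sharp A T (T x)) ^+ 2 + normA A (sharp A S (S x)) ^+ 2.
  rewrite !normA_sharpK_sqr// -{1}[iter 2 _ x]scale1r innerA_linearl mul1r.
  by rewrite raddfD.
rewrite innerA_sharp//.
have CS : Normc.normc (innerA A (T x) (S x)) ^+ 2 <=
    normA A (T x) ^+ 2 * normA A (S x) ^+ 2.
  rewrite -exprMn lerXn2r ?nnegrE ?mulr_ge0 ?normA_ge0 ?normc_ge0//.
  exact: innerA_CauchySchwarz.
rewrite (le_trans CS)//.
have := ler_pM (sqr_ge0 _) (sqr_ge0 _) (normA_sqr_le_sharpK _ _ TB x1)
  (normA_sqr_le_sharpK _ _ SB x1).
move=> /le_trans; apply.
(* The factor 1/2 comes from the inequality 2uv <= u^2 + v^2. *)
by have := sqr_ge0 (normA A (sharp A T (T x)) - normA A (sharp A S (S x))); nra.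
Qed.

Lemma Re_innerA_sum n (u : 'I_n -> H) x :
  complex.Re (innerA A (\sum_(k < n) u k) x) =
  \sum_(k < n) complex.Re (innerA A (u k) x).
Proof.
apply: (big_morph (fun u => complex.Re (innerA A u x))) => [v w|].
  by rewrite -[v]scale1r innerA_linearl mul1r scale1r raddfD.
by rewrite /innerA A0 linear0l.
Qed.

(** Passes from pointwise bounds to the supremum. When no x has |x|_A = 1 the supremum is 0, and 0
    <= c settles that case. *)
Lemma omegaA_sqr_le n (T : 'I_n -> H -> H) c : 0 <= c ->
  (forall x, normA A x = 1 ->
     \sum_(k < n) Normc.normc (innerA A (T k x) x) ^+ 2 <= c) ->
  omegaA A T ^+ 2 <= c.
Proof.
move=> c0 Tc; rewrite /omegaA; set E := (X in sup X).
have [[e Ee] |/nonemptyPn ->] := pselect (E !=set0); last by rewrite sup0 expr0n.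
have ubE : ubound E (Num.sqrt c) by move=> _ [x x1 <-]; rewrite ler_wsqrtr// Tc.
have e0 : 0 <= e by case: Ee => x _ <-; exact: sqrtr_ge0.
have E0 : 0 <= sup E by rewrite (le_trans e0)// ub_le_sup//; exists (Num.sqrt c).
by rewrite -(sqr_sqrtr c0) ler_pXn2r ?nnegrE ?sqrtr_ge0// ge_sup//; exists e.
Qed.

End semi_hilbertian.

Arguments Abounded {R H} A T.

(** * Optimization over the convex combinations *)

Theorem corollary3p27 (R : realType) (H : hilbertType R)
    (H_nontrivial : exists x : H, x != 0)
    (A : H -> H) (A_pos : positive_operator A)
    (n : nat) (n_ge1 : (1 <= n)%N)
    (T S : 'I_n -> H -> H)
    (T_BA : forall k, in_BA A (T k)) (S_BA : forall k, in_BA A (S k)) :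
  let Q : H -> H := fun x =>
    \sum_(k < n) (iter 2 (sharp A (T k) \o T k) x
                  + iter 2 (sharp A (S k) \o S k) x) in
  let bound : R := inf
    [set (ab.1 + ab.2)^-1 *
         (ab.1 / 2 * opnormA A Q
          + ab.2 * \sum_(k < n) opnormA A (sharp A (S k) \o T k) ^+ 2)
    | ab in [set ab : R * R | [/\ 0 <= ab.1, 0 <= ab.2 & ab != (0, 0)]]] in
  omegaA A (fun k => sharp A (S k) \o T k) ^+ 2 <= bound
  /\ bound <= 2^-1 * opnormA A Q.
Proof.
move=> Q bound.
have sharpK_bounded U : in_BA A U -> Abounded A (sharp A U \o U).
  by move=> UB; apply: Abounded_comp; [exact: Abounded_sharp|exact: in_BA_Abounded].
have Q_bounded : Abounded A Q.
  apply: (Abounded_sum A_pos) => k; apply: (Abounded_add A_pos).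
  - by apply: Abounded_comp; apply: sharpK_bounded.
  - by apply: Abounded_comp; apply: sharpK_bounded.
have Q_ge0 : 0 <= opnormA A Q by exact: opnormA_ge0.
have sum_ge0 : 0 <= \sum_(k < n) opnormA A (sharp A (S k) \o T k) ^+ 2.
  by apply: sumr_ge0 => k _; exact: sqr_ge0.
have omega_Q : omegaA A (fun k => sharp A (S k) \o T k) ^+ 2 <= 2^-1 * opnormA A Q.
  apply: omegaA_sqr_le => [|x x1]; first by rewrite mulr_ge0 ?invr_ge0.
  apply: (@le_trans _ _ (2^-1 * complex.Re (innerA A (Q x) x))).
    rewrite (Re_innerA_sum A_pos) mulr_sumr; apply: ler_sum => k _.
    exact: (innerA_sharp_comp_le A_pos).
  (* For |x|_A = 1, Re <Q x, x>_A <= |Q x|_A <= |Q|_A. *)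
  rewrite ler_pM2l ?invr_gt0// (le_trans (Re_le_normc _))//.
  rewrite (le_trans (innerA_CauchySchwarz A_pos _ _))// x1 mulr1.
  exact: opnormA_ub.
have omega_sum : omegaA A (fun k => sharp A (S k) \o T k) ^+ 2 <=
    \sum_(k < n) opnormA A (sharp A (S k) \o T k) ^+ 2.
  apply: omegaA_sqr_le => // x x1; apply: ler_sum => k _.
  rewrite ler_pXn2r ?nnegrE ?normc_ge0 ?opnormA_ge0//.
  rewrite (le_trans (innerA_CauchySchwarz A_pos _ _))// x1 mulr1.
  apply: opnormA_ub => //; apply: Abounded_comp.
    exact: (Abounded_sharp A_pos).
  exact: (in_BA_Abounded A_pos).
split.
  (* A lower bound passes to [inf] only for a nonempty set; the pair (1, 0) provides an element. *)
  apply: lb_le_inf.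
    by eexists; exists (1, 0); split=> //=; rewrite ?ler01// xpair_eqE oner_eq0.
  move=> _ [[a b] [/= a0 b0 ab0] <-].
  have ab1 : 0 < a + b.
    by rewrite lt_def addr_ge0// andbT paddr_eq0.
  rewrite ler_pdivlMl//.
  have := ler_wpM2l a0 omega_Q; have := ler_wpM2l b0 omega_sum.
  lra.
(* The set is bounded below by 0, and the pair (1, 0) gives the value |Q|_A / 2. *)
apply: ge_inf.
  exists 0 => _ [[a b] [/= a0 b0 ab0] <-].
  by rewrite mulr_ge0 ?invr_ge0 ?addr_ge0 ?mulr_ge0 ?invr_ge0.
exists (1, 0); first by split=> //=; rewrite ?ler01// xpair_eqE oner_eq0.
by rewrite /= mul0r !addr0 invr1 !mul1r.
Qed.
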